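(* Let $\Phi:H\to H$ be the two-parameter Hoffman map, i.e. the $\mathbb{K}$-linear map with $\Phi(\mathsf{e})=\mathsf{e}$ and $\Phi(\mathbf{a})=\sum_{I\in\mathcal{C}(\mathrm{rows}(\mathbf{a}))}\sum_{J\in\mathcal{C}(\mathrm{cols}(\mathbf{a}))}\frac{1}{I!\,J!}\,\mathbf{a}_{I,J}$ for nonempty $\mathbf{a}\in\mathrm{Comp}$. Then $\Phi$ is invertible, and its inverse satisfies $$\Phi^{-1}(\mathbf{a})=\sum_{I\in\mathcal{C}(\mathrm{rows}(\mathbf{a}))}\ \sum_{J\in\mathcal{C}(\mathrm{cols}(\mathbf{a}))}\frac{(-1)^{\mathrm{rows}(\mathbf{a})-\mathrm{len}(I)+\mathrm{cols}(\mathbf{a})-\mathrm{len}(J)}}{I_1\cdots I_{\mathrm{len}(I)}\,J_1\cdots J_{\mathrm{len}(J)}}\,\mathbf{a}_{I,J}$$ for every nonempty $\mathbf{a}\in\mathrm{Comp}$.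
   Context: $\mathbb{K}$ is a commutative $\mathbb{Q}$-algebra, $d\ge 1$, and $(\mathfrak{M}_d,\star,\varepsilon)$ is the free commutative monoid generated by $d$ letters, with neutral element $\varepsilon$. A matrix composition is either the empty composition $\mathsf{e}$ (with $0$ rows and $0$ columns) or a matrix of size $m\times n$, $m,n\ge 1$, with entries in $\mathfrak{M}_d$ having no row and no column consisting only of $\varepsilon$. $\mathrm{Comp}$ is the set of matrix compositions and $H=\bigoplus_{\mathbf{a}\in\mathrm{Comp}}\mathbb{K}\mathbf{a}$. $\mathrm{rows}(\mathbf{a})$ and $\mathrm{cols}(\mathbf{a})$ are the numbers of rows and columns of $\mathbf{a}$. $\mathcal{C}(n)$ is the set of (integer) compositions of $n$, i.e. tuples $I=(I_1,\dots,I_\ell)$ of positive integers with sum $n$; $\mathrm{len}(I)=\ell$ and $I!=I_1!\cdots I_\ell!$. For nonempty $\mathbf{a}\in\mathrm{Comp}$, $I\in\mathcal{C}(\mathrm{rows}(\mathbf{a}))$, $J\in\mathcal{C}(\mathrm{cols}(\mathbf{a}))$, the matrix $\mathbf{a}_{I,J}$ has size $\mathrm{len}(I)\times\mathrm{len}(J)$ and is obtained by fusing consecutive rows according to $I$ and consecutive columns according to $J$: its $(r,s)$ entry is $\bigstar_{u,v}\mathbf{a}_{u,v}$ over $I_1+\dots+I_{r-1}<u\le I_1+\dots+I_r$ and $J_1+\dots+J_{s-1}<v\le J_1+\dots+J_s$. *)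

(* Defs.v *)
From HB Require Import structures.
From mathcomp Require Import all_boot all_order all_algebra.
From mathcomp Require Import finmap monalg.

Set Implicit Arguments.
Unset Strict Implicit.
Unset Printing Implicit Defensive.

Import GRing.Theory.

Local Open Scope ring_scope.

Record composition (n : nat) := Composition {
  parts :> seq nat;
  _ : all (leq 1) parts && (sumn parts == n)
}.

HB.instance Definition _ n := [isSub for @parts n].
HB.instance Definition _ n := [Countable of composition n by <:].

Section CompositionFinite.
Variable n : nat.

Lemma parts_gt0 (I : composition n) k : k \in (I : seq nat) -> (0 < k)%N.
Proof. by case: I => s /= /andP[/allP h _] /h. Qed.

Lemma sum_parts (I : composition n) : sumn I = n.
Proof. by case: I => s /= /andP[_ /eqP]. Qed.

Lemma size_parts (I : composition n) : (size I <= n)%N.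
Proof.
rewrite -[X in (_ <= X)%N](sum_parts I).
case: I => s /= /andP[+ _]; elim: s => //= k s IHs /andP[k1 /IHs hs].
by rewrite -add1n leq_add.
Qed.

Lemma parts_le (I : composition n) k : k \in (I : seq nat) -> (k <= n)%N.
Proof.
rewrite -[X in (_ <= X)%N](sum_parts I).
elim: (parts I) => //= x s IHs; rewrite inE => /orP[/eqP->|/IHs].
  exact: leq_addr.
by move=> h; apply: leq_trans h (leq_addl _ _).
Qed.

Definition comp_code (I : composition n) : n.-bseq 'I_n.+1 :=
  insub_bseq n [seq inord k | k <- I].

Definition comp_decode (b : n.-bseq 'I_n.+1) : option (composition n) :=
  insub [seq val k | k <- b].

Lemma comp_codeK : pcancel comp_code comp_decode.
Proof.
move=> I; rewrite /comp_decode /comp_code /insub_bseq val_insubd.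
rewrite size_map size_parts -map_comp map_id_in ?valK // => k kI.
by rewrite /= inordK // ltnS (parts_le kI).
Qed.

HB.instance Definition _ : isFinite (composition n) := PCanIsFinite comp_codeK.

End CompositionFinite.

Definition composition_fact n (I : composition n) : nat := \prod_(k <- I) k`!.

Definition composition_prod n (I : composition n) : nat := \prod_(k <- I) k.

(* [{cmonom 'I_d}] is the free commutative monoid on [d] letters, with product
   [mmul] and neutral element [mone].  The only degenerate size allowed is
   0 x 0, which gives the empty composition. *)
Definition is_matcomp d m n (A : 'M[{cmonom 'I_d}]_(m, n)) : bool :=
  [&& (m == 0%N) == (n == 0%N),
      [forall i, exists j, A i j != mone] &
      [forall j, exists i, A i j != mone]].

Definition any_matrix d := {mn : nat * nat & 'M[{cmonom 'I_d}]_(mn.1, mn.2)}.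
HB.instance Definition _ d := Choice.on (any_matrix d).

Record matcomp d := Matcomp {
  matcomp_val : any_matrix d;
  _ : is_matcomp (tagged matcomp_val)
}.

HB.instance Definition _ d := [isSub for @matcomp_val d].
HB.instance Definition _ d := [Choice of matcomp d by <:].

Definition rows d (a : matcomp d) : nat := (tag (matcomp_val a)).1.
Definition cols d (a : matcomp d) : nat := (tag (matcomp_val a)).2.
Definition entries d (a : matcomp d) : 'M[{cmonom 'I_d}]_(rows a, cols a) :=
  tagged (matcomp_val a).

Lemma entriesP d (a : matcomp d) : is_matcomp (entries a).
Proof. exact: valP a. Qed.

Definition mk_matcomp d m n (A : 'M[{cmonom 'I_d}]_(m, n)) (hA : is_matcomp A) :
    matcomp d :=
  @Matcomp d (Tagged (fun mn => 'M[{cmonom 'I_d}]_(mn.1, mn.2)) (i := (m, n)) A)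
    hA.

Lemma empty_subproof d : is_matcomp (const_mx mone : 'M[{cmonom 'I_d}]_(0, 0)).
Proof. by apply/and3P; split=> //; apply/forallP; case. Qed.

Definition empty_matcomp d : matcomp d := mk_matcomp (empty_subproof d).

(* With blocks and indices numbered from 1 this condition reads
   I_1 + ... + I_(r-1) < u <= I_1 + ... + I_r; here both are numbered from 0. *)
Definition in_block (I : seq nat) (r u : nat) : bool :=
  (sumn (take r I) <= u < sumn (take r.+1 I))%N.

Definition fuse_mx d m n (A : 'M[{cmonom 'I_d}]_(m, n)) (I J : seq nat) :
    'M[{cmonom 'I_d}]_(size I, size J) :=
  \matrix_(r, s)
    \big[mmul/mone]_(u < m | in_block I r u)
      \big[mmul/mone]_(v < n | in_block J s v) A u v.

Lemma big_mmul_neq1 d (T : finType) (P : pred T) (F : T -> {cmonom 'I_d}) x :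
  P x -> F x != mone -> \big[mmul/mone]_(y | P y) F y != mone.
Proof.
by move=> Px; apply: contraNneq; rewrite (bigD1 x) //= => /unitm[->].
Qed.

Lemma in_block_exists (I : seq nat) u :
  (u < sumn I)%N -> exists r : 'I_(size I), in_block I r u.
Proof.
elim: I u => [|k I IHI] u //= hu; case: (ltnP u k) => huk.
  by exists ord0; rewrite /in_block /= take0 /= addn0.
have [|r hr] := IHI (u - k)%N; first by rewrite ltn_subLR.
exists (lift ord0 r); move: hr; rewrite /in_block lift0 /=.
by rewrite leq_subRL // ltn_subLR.
Qed.

Lemma in_block_inhabited n (I : composition n) (r : 'I_(size I)) :
  exists u : 'I_n, in_block I r u.
Proof.
have hlt : (sumn (take r I) < sumn (take r.+1 I))%N.
  rewrite (take_nth 0%N) // -cats1 sumn_cat /= addn0 -addn1 leq_add2l.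
  exact/(@parts_gt0 _ I)/mem_nth.
have hn : (sumn (take r I) < n)%N.
  rewrite -[X in (_ < X)%N](sum_parts I) -[X in (_ < sumn X)%N](cat_take_drop r.+1).
  by rewrite sumn_cat (leq_trans hlt) // leq_addr.
by exists (Ordinal hn); rewrite /in_block /= leqnn.
Qed.

Lemma composition_nil n (I : composition n) : (size I == 0%N) = (n == 0%N).
Proof.
apply/eqP/eqP => [/size0nil hI|n0]; first by rewrite -(sum_parts I) hI.
by have := size_parts I; rewrite [X in (_ <= X)%N]n0 leqn0 => /eqP.
Qed.

Lemma fuse_subproof d m n (A : 'M[{cmonom 'I_d}]_(m, n))
    (I : composition m) (J : composition n) :
  is_matcomp A -> is_matcomp (fuse_mx A I J).
Proof.
case/and3P=> hmn /forallP hr /forallP hc; apply/and3P; split.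
- by rewrite !composition_nil.
- apply/forallP => r; have [u hu] := in_block_inhabited r.
  have /existsP[v hv] := hr u.
  have [|s hs] := @in_block_exists J v; first by rewrite sum_parts.
  apply/existsP; exists s; rewrite mxE.
  by apply: (big_mmul_neq1 (x := u)) => //; apply: (big_mmul_neq1 (x := v)).
- apply/forallP => s; have [v hv] := in_block_inhabited s.
  have /existsP[u hu] := hc v.
  have [|r hr'] := @in_block_exists I u; first by rewrite sum_parts.
  apply/existsP; exists r; rewrite mxE.
  by apply: (big_mmul_neq1 (x := u)) => //; apply: (big_mmul_neq1 (x := v)).
Qed.

Definition fuse d (a : matcomp d)
    (I : composition (rows a)) (J : composition (cols a)) : matcomp d :=
  mk_matcomp (fuse_subproof I J (entriesP a)).

Section LinearExtension.
Variables (R : nzRingType) (T : choiceType) (V : lmodType R) (f : T -> V).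

Definition lin_ext (x : {malg R[T]}) : V := \sum_(k <- msupp x) x@_k *: f k.

Lemma lin_extEw (D : {fset T}) (x : {malg R[T]}) :
  (msupp x `<=` D)%fset -> lin_ext x = \sum_(k <- D) x@_k *: f k.
Proof.
move=> sD; rewrite /lin_ext; apply: big_fset_incl => // k _ hk.
by rewrite mcoeff_outdom // scale0r.
Qed.

Lemma lin_ext_linear : linear lin_ext.
Proof.
move=> c x y.
set D := (msupp (c *: x + y) `|` msupp x `|` msupp y)%fset.
have s1 : (msupp (c *: x + y) `<=` D)%fset.
  by apply/fsubsetP => k hk; rewrite !inE hk.
have s2 : (msupp x `<=` D)%fset by apply/fsubsetP => k hk; rewrite !inE hk orbT.
have s3 : (msupp y `<=` D)%fset by apply/fsubsetP => k hk; rewrite !inE hk orbT.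
rewrite (lin_extEw s1) (lin_extEw s2) (lin_extEw s3) scaler_sumr -big_split /=.
by apply: eq_bigr => k _; rewrite mcoeffD mcoeffZ scalerDl scalerA.
Qed.

HB.instance Definition _ :=
  GRing.isLinear.Build R {malg R[T]} V *:%R lin_ext lin_ext_linear.

Lemma lin_extU k : lin_ext << k >> = f k.
Proof.
by rewrite /lin_ext msuppU oner_eq0 big_seq_fset1 mcoeffUU scale1r.
Qed.

End LinearExtension.

(* [{malg K[matcomp d]}] is the free [K]-module on [matcomp d]; [<< a >>] is the
   basis vector of [a], and [q%:A] the image in [K] of the rational [q]. *)
Definition hoffman_basis (K : comAlgType rat) d (a : matcomp d) :
    {malg K[matcomp d]} :=
  if a == empty_matcomp d then << empty_matcomp d >>
  else \sum_(I : composition (rows a)) \sum_(J : composition (cols a))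
         (((composition_fact I * composition_fact J)%:R)^-1 : rat)%:A
           *: << fuse I J >>.

Definition hoffman (K : comAlgType rat) d :
    {linear {malg K[matcomp d]} -> {malg K[matcomp d]}} :=
  lin_ext (@hoffman_basis K d).

Lemma hoffmanE (K : comAlgType rat) d (a : matcomp d) :
  hoffman K d << a >> = hoffman_basis K a.
Proof. exact: lin_extU. Qed.

(* Main.v *)
Require Import Defs.
From HB Require Import structures.
From mathcomp Require Import all_boot all_order all_algebra.
From mathcomp Require Import finmap monalg.

Set Implicit Arguments.
Unset Strict Implicit.
Unset Printing Implicit Defensive.

Import GRing.Theory.

Local Open Scope ring_scope.

(** Attach to a sequence [f 1, f 2, ...] of scalars the operator
    [T_f a = \sum_I \sum_J f(I) f(J) a_(I,J)], where [f(I)] is the product of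
    the [f k] over the parts [k] of [I]; this is [lin_ext (fuse_sum f)] below.
    The Hoffman map is [T_f] for [f k = 1 / k!], and the announced inverse is
    [T_g] for [g k = (-1)^(k-1) / k].  These are the coefficients of
    [F(x) = exp x - 1] and [G(x) = log (1 + x)], and the point is that
    [T_g \o T_f] is the operator attached to the power series [G \o F].

    Indeed fusing twice is fusing once: [(a_(I,J))_(I',J') = a_(L,M)], where
    the composition [L] is obtained from [I] by adding up consecutive parts as
    told by [I'], and likewise for [M] ([fuse_fuse]).  Choosing a pair
    [(I, I')] with result [L] amounts to choosing, for every part [k] of [L]
    independently, a composition of [k], namely the run of parts of [I] summed
    into [k].  Hence the total weight of the pairs giving [L] is the product
    over the parts [k] of [L] of
    [\sum_(I composition of k) f(I) * g (len I)]  ([sum_comp_merge]),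
    which is the coefficient of [x^k] in [G(F(x))] ([wconvE]).  When
    [G(F(x)) = x], only the composition [L = (1, ..., 1)] survives, and fusing
    along it does nothing.  Rows and columns are independent, so the
    one-dimensional statement is applied twice.

    It remains to see that [log (exp x) = x] and [exp (log (1 + x)) = 1 + x] as
    formal power series.  Truncating at order [N] turns them into congruences
    modulo [x^N] between rational polynomials; both follow by differentiating
    ([log_exp_trunc], [exp_log_trunc]). *)

(** * Sums over compositions *)

Lemma is_comp_ones n :
  all (leq 1) (nseq n 1%N) && (sumn (nseq n 1%N) == n).
Proof. by rewrite all_nseq orbT sumn_nseq mul1n eqxx. Qed.

Definition comp_ones n : composition n := Composition (is_comp_ones n).

Lemma is_comp_cons n (k : 'I_n.+1) (J : composition (n - k)) :
  all (leq 1) (k.+1 :: J) && (sumn (k.+1 :: J) == n.+1).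
Proof.
have le_kn : (k <= n)%N by rewrite -ltnS.
rewrite /= (sum_parts J) addSn subnKC // eqxx andbT.
by apply/allP => i /parts_gt0.
Qed.

Definition comp_cons n (k : 'I_n.+1) (J : composition (n - k)) :
  composition n.+1 := Composition (is_comp_cons J).

Section Sums.
Variable V : nmodType.

Lemma sum_composition0 (F : composition 0 -> V) :
  \sum_(I : composition 0) F I = F (comp_ones 0).
Proof.
rewrite (big_pred1 (comp_ones 0)) // => I /=; apply/esym/eqP/val_inj => /=.
by apply/nilP; rewrite /nilp composition_nil.
Qed.

(** Summands defined on plain sequences let sums over compositions of varying
    integers be compared without casts. *)
Lemma sum_comp0 (F : seq nat -> V) : \sum_(I : composition 0) F I = F [::].
Proof. exact: sum_composition0. Qed.

(** Sorting the compositions of [n + 1] by their first part. *)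
Lemma sum_compS n (F : seq nat -> V) :
  \sum_(I : composition n.+1) F I =
  \sum_(k < n.+1) \sum_(J : composition (n - k)) F (k.+1 :: J).
Proof.
rewrite (partition_big
  (fun I : composition n.+1 => inord (head 0%N I).-1 : 'I_n.+1) predT) //=.
apply: eq_bigr => k _.
have behead_comp (I : composition n.+1) : inord (head 0%N I).-1 == k ->
    exists J : composition (n - k), I = comp_cons J.
  case: I => -[|[|i] s] //= hs; have /andP[ps /eqP es] := hs.
  have lein : (i < n.+1)%N by rewrite -es ltnS leq_addr.
  move/eqP=> ek; have eik : i = k by rewrite -ek inordK.
  have hJ : all (leq 1) s && (sumn s == (n - k)%N).
    by rewrite ps -eik; move: es; rewrite addSn => -[<-]; rewrite addKn eqxx.
  by exists (Composition hJ); apply: val_inj; rewrite /= eik.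
rewrite (reindex (@comp_cons n k)) /=; first by rewrite inord_val eqxx.
exists (fun I : composition n.+1 => insubd (comp_ones _) (behead I)).
  by move=> J _; exact: valKd.
move=> I; rewrite inE => /behead_comp[J ->]; apply: val_inj.
by rewrite /= valKd.
Qed.

Lemma sum_triangle n (A : nat -> nat -> V) :
  \sum_(j < n) \sum_(i < n - j) A j i =
  \sum_(k < n) \sum_(j < k.+1) A j (k - j)%N.
Proof.
elim: n => [|n IHn]; first by rewrite !big_ord0.
rewrite [RHS]big_ord_recr -IHn /=.
have {IHn} -> : \sum_(j < n) \sum_(i < n - j) A j i =
    \sum_(j < n.+1) \sum_(i < n - j) A j i.
  by rewrite [RHS]big_ord_recr /= subnn big_ord0 addr0.
rewrite -big_split; apply: eq_bigr => j _ /=.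
by rewrite subSn -1?ltnS // big_ord_recr.
Qed.

(** Cutting a composition of [n] between two of its parts yields a composition
    of some [k <= n] followed by one of [n - k], and conversely. *)
Lemma sum_comp_split n (H : seq nat -> seq nat -> V) :
  \sum_(I : composition n) \sum_(m < (size I).+1) H (take m I) (drop m I) =
  \sum_(k < n.+1) \sum_(X : composition k) \sum_(Y : composition (n - k)) H X Y.
Proof.
elim/ltn_ind: n H => -[|n] IH H.
  rewrite (sum_comp0 (fun I : seq nat =>
    \sum_(m < (size I).+1) H (take m I) (drop m I))).
  rewrite !big_ord_recl !big_ord0 /=.
  rewrite (sum_comp0 (fun X : seq nat =>
    \sum_(Y : composition (0 - 0)) H X Y)).
  by rewrite (sum_comp0 (H _)).
rewrite (eq_bigr (fun I : composition n.+1 => H [::] I +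
  \sum_(m < size I) H (take m.+1 I) (drop m.+1 I))); last first.
  by move=> I _; rewrite big_ord_recl take0 drop0.
rewrite big_split /= [RHS]big_ord_recl; congr (_ + _).
  by rewrite (sum_comp0 (fun X : seq nat =>
    \sum_(Y : composition (n.+1 - 0)) H X Y)).
rewrite (sum_compS n (fun I : seq nat =>
  \sum_(m < size I) H (take m.+1 I) (drop m.+1 I))).
transitivity (\sum_(j < n.+1) \sum_(i < n.+1 - j) \sum_(X : composition i)
    \sum_(Y : composition (n - j - i)) H (j.+1 :: X) Y).
  apply: eq_bigr => j _.
  rewrite (IH (n - j)%N _ (fun X Y => H (j.+1 :: X) Y)) ?ltnS ?leq_subr //.
  by rewrite subSn // -ltnS.
rewrite (sum_triangle n.+1 (fun j i => \sum_(X : composition i)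
    \sum_(Y : composition (n - j - i)) H (j.+1 :: X) Y)).
apply: eq_bigr => k _; rewrite lift0 subSS.
rewrite (sum_compS k (fun X : seq nat =>
  \sum_(Y : composition (n - k)) H X Y)).
apply: eq_bigr => j _; apply: eq_bigr => X _.
by rewrite -subnDA subnKC // -ltnS.
Qed.

End Sums.

(** * Merging the parts of a composition *)

Definition merge (I I' : seq nat) : seq nat := map sumn (reshape I' I).

Lemma is_comp_merge n (I : composition n) (I' : composition (size I)) :
  all (leq 1) (merge I I') && (sumn (merge I I') == n).
Proof.
have sI' := sum_parts I'.
rewrite /merge -sumn_flatten reshapeKr ?sI' // (sum_parts I) eqxx andbT.
apply/(all_nthP 0%N) => i; rewrite size_map size_reshape => lti.
rewrite (nth_map [::]) ?size_reshape //.
have : size (nth [::] (reshape I' I) i) = nth 0%N I' i.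
  by rewrite -(nth_map _ 0%N) ?size_reshape // -/(shape _) reshapeKl ?sI'.
have : (0 < nth 0%N I' i)%N by apply/(@parts_gt0 _ I')/mem_nth.
have : {subset nth [::] (reshape I' I) i <= (I : seq nat)}.
  move=> k hk; rewrite -[X in _ \in X](@reshapeKr _ I' I) ?sI' //.
  apply/flattenP; exists (nth [::] (reshape I' I) i) => //.
  by rewrite mem_nth ?size_reshape.
case: (nth [::] (reshape I' I) i) => [|k s] hs; first by move=> /[swap] <-.
move=> _ _ /=; apply: leq_trans (leq_addr _ _).
by apply: (@parts_gt0 _ I); apply: hs; rewrite mem_head.
Qed.

Definition comp_merge n (I : composition n) (I' : composition (size I)) :
  composition n := Composition (is_comp_merge I').

Section Convolution.
Variables (R : comNzRingType) (f g : nat -> R).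

Definition weight (h : nat -> R) (s : seq nat) : R := \prod_(k <- s) h k.

(** For [k > 0] this is the coefficient of [x^k] in [G(F(x))], where
    [F = \sum_(i > 0) f i x^i] and [G = \sum_(l > 0) g l x^l]. *)
Definition wconv k : R :=
  \sum_(I : composition k) weight f I * g (size I).

Lemma weight_cons h k s : weight h (k :: s) = h k * weight h s.
Proof. exact: big_cons. Qed.

(** The first part of [I'] singles out an initial run [X] of parts of [I], to be
    summed into the first part [k] of the merged composition.  Cutting [I] after
    [X], the choices of [X] contribute [wconv k], and what remains is the same
    sum for [n - k]. *)
Lemma sum_comp_merge_seq (V : lmodType R) n (F : seq nat -> V) :
  \sum_(I : composition n) \sum_(I' : composition (size I))
     (weight f I * weight g I') *: F (merge I I') =
  \sum_(L : composition n) weight wconv L *: F L.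
Proof.
elim/ltn_ind: n F => -[|n] IH F.
  rewrite (sum_comp0 (fun I : seq nat => \sum_(I' : composition (size I))
     (weight f I * weight g I') *: F (merge I I'))).
  rewrite (sum_comp0 (fun I' : seq nat =>
     (weight f [::] * weight g I') *: F (merge [::] I'))).
  rewrite (sum_comp0 (fun L => weight wconv L *: F L)).
  by rewrite /weight !big_nil mulr1.
pose H X Y := \sum_(I' : composition (size Y))
  (weight f (X ++ Y) * (g (size X) * weight g I')) *: F (sumn X :: merge Y I').
(* The initial run is nonempty, so the terms with an empty left piece have to
   be cancelled from both sides of the splitting identity. *)
have := sum_comp_split n.+1 H.
under eq_bigr => I _ do rewrite big_ord_recl take0 drop0.
rewrite big_split /= [RHS]big_ord_recl.
rewrite (sum_comp0 (fun X : seq nat =>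
  \sum_(Y : composition (n.+1 - 0)) H X Y)).
move/addrI => E; rewrite (sum_compS n (fun L => weight wconv L *: F L)).
transitivity (\sum_(I : composition n.+1) \sum_(i < size I)
   H (take (bump 0 i) I) (drop (bump 0 i) I)).
  apply: eq_bigr => I _; have sI : (0 < size I)%N.
    by rewrite lt0n composition_nil.
  move: (I : seq nat) sI => {I} s; case sm: (size s) => [|m] // _.
  rewrite (sum_compS m (fun I' =>
    (weight f s * weight g I') *: F (merge s I'))).
  apply: eq_bigr => i _; rewrite /H size_drop sm /bump /= add1n subSS.
  apply: eq_bigr => I' _.
  by rewrite cat_take_drop size_takel ?sm // weight_cons /merge /=.
rewrite {}E; apply: eq_bigr => k _.
rewrite lift0 subSS.
under eq_bigr => X _.
  rewrite (eq_bigr (fun Y : composition (n - k) =>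
    (weight f X * g (size X)) *:
      \sum_(I' : composition (size Y)) (weight f Y * weight g I') *:
         F (k.+1 :: merge Y I'))); last first.
    move=> Y _; rewrite scaler_sumr; apply: eq_bigr => I' _.
    by rewrite scalerA (sum_parts X) /weight big_cat mulrACA.
  rewrite -scaler_sumr (IH _ _ (fun L => F (k.+1 :: L))) ?ltnS ?leq_subr //.
  over.
rewrite -scaler_suml scaler_sumr; apply: eq_bigr => L _.
by rewrite scalerA weight_cons.
Qed.

Lemma sum_comp_merge (V : lmodType R) n (F : composition n -> V) :
  \sum_(I : composition n) \sum_(I' : composition (size I))
     (weight f I * weight g I') *: F (comp_merge I') =
  \sum_(L : composition n) weight wconv L *: F L.
Proof.
(* The value off the compositions of [n] is irrelevant. *)
pose G s := oapp F 0 (insub s).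
have GE (L : composition n) : G L = F L by rewrite /G valK.
transitivity (\sum_(L : composition n) weight wconv L *: G L); last first.
  by apply: eq_bigr => L _; rewrite GE.
rewrite -sum_comp_merge_seq; apply: eq_bigr => I _; apply: eq_bigr => I' _.
by rewrite -GE.
Qed.

(** The hypothesis says that the power series [G] is a left inverse of [F] for
    composition. *)
Lemma sum_comp_merge_inv (V : lmodType R) n (F : composition n -> V) :
  (forall k, wconv k.+1 = (k == 0%N)%:R) ->
  \sum_(I : composition n) \sum_(I' : composition (size I))
     (weight f I * weight g I') *: F (comp_merge I') = F (comp_ones n).
Proof.
move=> wconv1; rewrite sum_comp_merge (bigD1 (comp_ones n)) //= big1.
  rewrite addr0 /weight /= big1_seq ?scale1r // => k /andP[_].
  by rewrite mem_nseq => /andP[_ /eqP->]; rewrite wconv1.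
move=> L neL.
have [k kL nek1] : exists2 k, k \in (L : seq nat) & k != 1%N.
  apply/hasP; apply: contraR neL => /hasPn all1.
  have /all_pred1P eL : all (pred1 1%N) L.
    by apply/allP => k /all1; rewrite negbK.
  apply/eqP/val_inj; rewrite /= eL; congr nseq.
  by rewrite -[RHS](sum_parts L) eL sumn_nseq mul1n size_nseq.
case: k kL (parts_gt0 kL) nek1 => // k kL _ nek1.
rewrite /weight (perm_big _ (perm_to_rem kL)) big_cons wconv1.
by move: nek1; rewrite eqSS => /negPf->; rewrite mulr0n /= mul0r scale0r.
Qed.

End Convolution.

Lemma rmorph_weight (R S : comNzRingType) (phi : {rmorphism R -> S}) f s :
  weight (fun k => phi (f k)) s = phi (weight f s).
Proof. by rewrite /weight rmorph_prod. Qed.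

Lemma rmorph_wconv (R S : comNzRingType) (phi : {rmorphism R -> S}) f g k :
  wconv (fun k => phi (f k)) (fun k => phi (g k)) k = phi (wconv f g k).
Proof.
rewrite /wconv rmorph_sum; apply: eq_bigr => I _.
by rewrite rmorph_weight rmorphM.
Qed.

(** * Truncated exponential and logarithm *)

Definition exp_weight (k : nat) : rat := (k`!%:R)^-1.
Definition log_weight (k : nat) : rat := (-1) ^+ k.-1 / k%:R.

Lemma weight_expE n (I : composition n) :
  weight exp_weight I = ((composition_fact I)%:R)^-1.
Proof. by rewrite /weight /exp_weight prodfV /composition_fact natr_prod. Qed.

Lemma weight_logE n (I : composition n) :
  weight log_weight I = (-1) ^+ (n - size I) / (composition_prod I)%:R.
Proof.
have sum_pred (s : seq nat) : all (leq 1) s ->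
    (\sum_(k <- s) k.-1 + size s)%N = sumn s.
  elim: s => [|k s IHs] /=; first by rewrite big_nil.
  by case: k => //= k /IHs <-; rewrite big_cons /= addnS addSn addnA.
rewrite /weight /log_weight big_split /= prodfV /composition_prod natr_prod.
congr (_ / _); rewrite -expr_sum -[X in (X - _)%N](sum_parts I).
rewrite -sum_pred ?addnK //.
by apply/allP => k /parts_gt0.
Qed.

(** The polynomial [\sum_(1 <= i <= N) f i x^i], with the factor [x] kept in
    front so that its powers are visibly divisible by powers of [x]. *)
Definition trunc (N : nat) (f : nat -> rat) : {poly rat} :=
  'X * \poly_(i < N) f i.+1.

Definition comp_trunc N (g f : nat -> rat) : {poly rat} :=
  \sum_(l < N.+1) g l *: trunc N f ^+ l.

Lemma natS_neq0 n : n.+1%:R != 0 :> rat.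
Proof. by rewrite Num.Theory.pnatr_eq0. Qed.

Lemma exp_weightS k : exp_weight k.+1 *+ k.+1 = exp_weight k.
Proof.
rewrite /exp_weight factS natrM invfM -[_ *+ _]mulr_natr mulrAC.
by rewrite mulVf ?mul1r ?natS_neq0.
Qed.

Lemma log_weightS k : log_weight k.+1 *+ k.+1 = (-1) ^+ k.
Proof.
by rewrite /log_weight -[_ *+ _]mulr_natr mulrVK // unitfE natS_neq0.
Qed.

Lemma coef_trunc N f i :
  (trunc N f)`_i = if (0 < i <= N)%N then f i else 0.
Proof. by rewrite coefXM; case: i => //= i; rewrite coef_poly. Qed.

Lemma trunc_powS N f : exists q, trunc N f ^+ N = q * 'X^N.
Proof.
exists ((\poly_(i < N) f i.+1) ^+ N).
by rewrite /trunc exprMn mulrC.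
Qed.

Lemma coef_addMXn (p q : {poly rat}) N i :
  (i < N)%N -> (p + q * 'X^N)`_i = p`_i.
Proof. by move=> ltiN; rewrite coefD coefMXn ltiN addr0. Qed.

(** [wconv f g] sums over compositions of unbounded length, but those of length
    at least [M > k] and the parts above [N >= k] do not occur.  Sorting by the
    first part matches the expansion of [F * (F^l)] in [F^(l+1)]. *)
Lemma wconvE N M (f g : nat -> rat) k : (k < M)%N -> (k <= N)%N ->
  wconv f g k = (\sum_(l < M) g l *: trunc N f ^+ l)`_k.
Proof.
elim/ltn_ind: k M g => k IH [|M] // g ltkM lekN.
rewrite big_ord_recl expr0 coefD coefZ coef1.
under eq_bigr => l _ do rewrite lift0 exprS scalerAr.
rewrite -mulr_sumr coefM.
case: k IH ltkM lekN => [|k] IH ltkM lekN.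
  rewrite big_ord1 coef_trunc mul0r addr0 mulr1 /wconv.
  rewrite (sum_comp0 (fun I => weight f I * g (size I))).
  by rewrite /weight big_nil mul1r.
rewrite mulr0 add0r big_ord_recl coef_trunc mul0r add0r /wconv.
rewrite (sum_compS k (fun I => weight f I * g (size I))).
apply: eq_bigr => j _; rewrite lift0 subSS.
have lejk : (j <= k)%N by rewrite -ltnS.
rewrite coef_trunc (leq_trans _ lekN) //= -(IH _ _ M (fun l => g l.+1)).
- by rewrite /wconv mulr_sumr; apply: eq_bigr => I _; rewrite weight_cons mulrA.
- by rewrite ltnS leq_subr.
- by rewrite (leq_ltn_trans (leq_subr _ _)).
- by rewrite (leq_trans (leq_subr _ _)) // ltnW.
Qed.

(** [F' = 1 + F] for [F = exp x - 1], with the error due to truncation. *)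
Lemma deriv_exp_trunc N :
  (trunc N exp_weight)^`() = 1 + trunc N exp_weight - exp_weight N *: 'X^N.
Proof.
apply/polyP => i; rewrite coef_deriv coefB coefD coefZ coef1 coefXn !coef_trunc.
case: (ltngtP i N) => [ltiN|gtiN|->]; rewrite ?andbF ?andbT ?ltn0Sn.
- rewrite exp_weightS mulr0 subr0; case: i ltiN => [|i] _ /=.
    by rewrite addr0 /exp_weight fact0 invr1.
  by rewrite add0r.
- by case: i gtiN => // i _; rewrite !(mul0rn, mulr0, addr0, subr0).
- rewrite mul0rn mulr1; case: N => [|N] /=.
    by rewrite addr0 /exp_weight fact0 invr1 subrr.
  by rewrite add0r subrr.
Qed.

(** [(1 + x) Y' = 1] for [Y = log (1 + x)], with the error due to
    truncation. *)
Lemma deriv_log_trunc N :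
  (1 + 'X) * (trunc N log_weight)^`() = 1 - (-1) ^+ N *: 'X^N.
Proof.
have Y'E i : (trunc N log_weight)^`()`_i = if (i < N)%N then (-1) ^+ i else 0.
  rewrite coef_deriv coef_trunc ltn0Sn /=.
  by case: ltnP => _; rewrite ?log_weightS ?mul0rn.
apply/polyP => i.
rewrite mulrDl mul1r coefD coefXM coefB coefZ coef1 coefXn !Y'E.
case: i => [|i]; rewrite /=.
  case: N {Y'E} => [|N]; first by rewrite mulr1 subrr.
  by rewrite mulr0 addr0.
rewrite sub0r; case: (ltngtP i.+1 N) => [ltiN|gtiN|<-].
- by rewrite exprS mulN1r addNr mulr0 oppr0.
- by rewrite /= addr0 mulr0 oppr0.
- by rewrite add0r exprS mulN1r mulr1 opprK.
Qed.

Lemma deriv_comp_trunc N g f : (comp_trunc N g f)^`() =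
  (trunc N f)^`() * \sum_(l < N) (g l.+1 *+ l.+1) *: trunc N f ^+ l.
Proof.
rewrite /comp_trunc raddf_sum /= big_ord_recl expr0 derivZ derivC scaler0 add0r.
rewrite mulr_sumr; apply: eq_bigr => l _.
by rewrite lift0 derivZ deriv_exp -scalerMnl -scalerMnr scalerAr -mulrnAr.
Qed.

(** [log (exp x) = x]: writing [F = exp x - 1], the derivative of
    [log (1 + F)] is [F' * (1 - F + F^2 - ...) = (1 + F) / (1 + F) = 1]. *)
Lemma log_exp_trunc N i : (i < N)%N ->
  (comp_trunc N log_weight exp_weight)`_i.+1 = (i == 0%N)%:R.
Proof.
move=> ltiN; set P := comp_trunc _ _ _; set F := trunc N exp_weight.
pose G := \sum_(l < N) (- F) ^+ l.
have [Q FN] := trunc_powS N exp_weight.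
have dP : P^`() = 1 + (- ((-1) ^+ N * Q) - exp_weight N *: G) * 'X^N.
  rewrite /P deriv_comp_trunc deriv_exp_trunc -/F.
  have -> : \sum_(l < N) (log_weight l.+1 *+ l.+1) *: F ^+ l = G.
    apply: eq_bigr => l _.
    by rewrite log_weightS [(- F) ^+ l]exprNn -mul_polyC rmorphXn rmorphN1.
  have FG : (1 + F) * G = 1 - (-1) ^+ N * (Q * 'X^N).
    rewrite -FN -exprNn; have := subrXX 1 (- F) N.
    rewrite expr1n opprK => ->; congr (_ * _).
    by apply: eq_bigr => l _; rewrite expr1n mul1r.
  rewrite mulrBl FG mulrDl !mulNr -scalerAl -scalerAl addrA mulrA.
  by rewrite [_ * G]mulrC.
have := coef_deriv P i; rewrite dP coef_addMXn // coef1 => /esym/eqP.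
case: i ltiN => [|i] _ /=; first by rewrite mulr1n => /eqP.
by rewrite Num.Theory.mulrn_eq0 => /eqP.
Qed.

(** [exp (log (1 + x)) = 1 + x]: the series [P = exp Y] with [Y = log (1 + x)]
    satisfies [(1 + x) P' = P], that is [(j + 1) p_(j+1) + j p_j = p_j] for its
    coefficients, and [p_0 = 1]; hence [p_1 = 1] and [p_j = 0] for [j > 1]. *)
Lemma exp_log_trunc N i : (i < N)%N ->
  (comp_trunc N exp_weight log_weight)`_i.+1 = (i == 0%N)%:R.
Proof.
set P := comp_trunc _ _ _; set Y := trunc N log_weight.
have [Q YN] := trunc_powS N log_weight.
pose G := \sum_(l < N) exp_weight l *: Y ^+ l.
have PG : P = G + exp_weight N *: (Q * 'X^N).
  by rewrite -YN /P /comp_trunc big_ord_recr.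
have dP : (1 + 'X) * P^`() = P +
    (- (exp_weight N *: Q) - (-1) ^+ N *: G) * 'X^N.
  rewrite /P deriv_comp_trunc mulrA deriv_log_trunc -/Y.
  under eq_bigr => l _ do rewrite exp_weightS.
  rewrite -/G -/P PG mulrBl mul1r mulrDl !mulNr -!scalerAl addrA addrK.
  by rewrite ['X^N * G]mulrC.
have rec j : (j < N)%N -> P`_j.+1 *+ j.+1 + P`_j *+ j = P`_j.
  move=> ltjN; have := congr1 (fun p : {poly rat} => p`_j) dP.
  rewrite coef_addMXn // mulrDl mul1r coefD coefXM !coef_deriv => E.
  by rewrite -[RHS]E; case: (j) => //=; rewrite mulr0n.
have P0 : P`_0 = 1.
  rewrite /P /comp_trunc big_ord_recl coefD coefZ coef1 coef_sum big1.
    by rewrite addr0 mulr1 /exp_weight fact0 invr1.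
  by move=> l _; rewrite lift0 coefZ exprS /Y /trunc -mulrA coefXM mulr0.
elim: i => [|i IHi] ltiN.
  by have := rec _ ltiN; rewrite P0 mulr0n addr0.
have := rec _ ltiN; rewrite IHi ?(ltnW ltiN) //.
case: i {IHi} ltiN => [|i] ltiN /=.
  rewrite mulr1n -[X in _ = X]add0r => /addIr/eqP.
  by rewrite Num.Theory.mulrn_eq0 => /eqP.
rewrite mul0rn addr0 => /eqP.
by rewrite Num.Theory.mulrn_eq0 => /eqP.
Qed.

Lemma wconv_exp_log k : wconv exp_weight log_weight k.+1 = (k == 0%N)%:R.
Proof.
by rewrite (@wconvE k.+1 k.+2) // -/(comp_trunc _ _ _) log_exp_trunc.
Qed.

Lemma wconv_log_exp k : wconv log_weight exp_weight k.+1 = (k == 0%N)%:R.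
Proof.
by rewrite (@wconvE k.+1 k.+2) // -/(comp_trunc _ _ _) exp_log_trunc.
Qed.

(** * Blocks of a merged composition *)

Lemma sumn_take_merge p I I' :
  sumn (take p (merge I I')) = sumn (take (sumn (take p I')) I).
Proof.
elim: I' p I => [|k I' IHI] [|p] I //=; rewrite ?take0 //.
by rewrite takeD sumn_cat -IHI.
Qed.

Lemma leq_sumn_take (I : seq nat) :
  {homo (fun x => sumn (take x I)) : x y / (x <= y)%N}.
Proof.
move=> x y lexy /=; rewrite -(subnKC lexy) takeD sumn_cat; exact: leq_addr.
Qed.

(** The endpoints of the [p]-th block of [merge I I'] are partial sums of [I]
    taken at the endpoints of the [p]-th block of [I'], so a merged block is a
    union of blocks of [I]. *)
Lemma in_block_merge (I I' : seq nat) p r u : in_block I r u ->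
  in_block (merge I I') p u = in_block I' p r.
Proof.
rewrite /in_block !sumn_take_merge => /andP[ler ltr].
apply/andP/andP => -[le1 lt2]; split.
- rewrite leqNgt; apply/negP => /(leq_sumn_take I) /=.
  by rewrite leqNgt (leq_ltn_trans le1).
- rewrite ltnNge; apply/negP => /(leq_sumn_take I) /=.
  by rewrite leqNgt (leq_ltn_trans ler).
- exact: leq_trans (leq_sumn_take I le1) ler.
- exact: leq_trans ltr (leq_sumn_take I lt2).
Qed.

Lemma in_block_uniq (I : seq nat) r r' u :
  in_block I r u -> in_block I r' u -> r = r'.
Proof.
wlog ltrr : r r' / (r < r')%N => [hw|] hr hr'.
  by case: (ltngtP r r') => // h; [exact: hw | apply/esym/hw].
move: hr hr' => /andP[_ h1] /andP[h2 _].
by have := leq_trans h1 (leq_trans (leq_sumn_take I ltrr) h2); rewrite ltnn.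
Qed.

Lemma big_in_block_merge (T : Type) (idx : T) (op : Monoid.com_law idx)
    n (I : composition n) (I' : composition (size I)) p (F : 'I_n -> T) :
  \big[op/idx]_(r < size I | in_block I' p r)
     \big[op/idx]_(u < n | in_block I r u) F u =
  \big[op/idx]_(u < n | in_block (merge I I') p u) F u.
Proof.
rewrite (exchange_big_dep (fun u : 'I_n => in_block (merge I I') p u)) /=.
  apply: eq_bigr => u hu.
  have [|r0 hr0] := @in_block_exists I u; first by rewrite sum_parts.
  rewrite (big_pred1 r0) // => r /=; apply/andP/eqP => [[_ hr]|->].
    exact/val_inj/(in_block_uniq hr).
  by rewrite -(in_block_merge _ _ hr0).
by move=> r u h1 h2; rewrite (in_block_merge _ _ h2).
Qed.

Lemma in_block_ones n i u : (i < n)%N -> in_block (nseq n 1%N) i u = (u == i).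
Proof.
move=> ltin; rewrite /in_block !take_nseq ?sumn_nseq ?mul1n //; last first.
  exact: ltnW.
by rewrite ltnS eqn_leq andbC.
Qed.

(** * Fusing matrix compositions *)

Section Fuse.
Variable d : nat.
Implicit Type a : matcomp d.

(** Two matrices whose sizes are only propositionally equal are compared entry
    by entry through the values of their indices. *)
Lemma mk_matcomp_eq m n m' n' (A : 'M[{cmonom 'I_d}]_(m, n))
    (B : 'M[{cmonom 'I_d}]_(m', n')) (hA : is_matcomp A) (hB : is_matcomp B) :
  m = m' -> n = n' ->
  (forall (i : 'I_m) (j : 'I_n) (i' : 'I_m') (j' : 'I_n'),
     i = i' :> nat -> j = j' :> nat -> A i j = B i' j') ->
  mk_matcomp hA = mk_matcomp hB.
Proof.
move=> em en; subst m' n' => eAB; apply: val_inj; congr Tagged.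
by apply/matrixP => i j; exact: eAB.
Qed.

Lemma fuse_fuse a (I : composition (rows a)) (J : composition (cols a))
    (I' : composition (size I)) (J' : composition (size J)) :
  @fuse d (fuse I J) I' J' = fuse (comp_merge I') (comp_merge J').
Proof.
apply: mk_matcomp_eq; rewrite /= ?size_map ?size_reshape // => r s r' s' er es.
rewrite !mxE -er -es.
under [RHS]eq_bigr => u _ do rewrite -big_in_block_merge.
rewrite -big_in_block_merge; apply: eq_bigr => p _.
rewrite exchange_big; apply: eq_bigr => q _ /=.
by rewrite mxE.
Qed.

Lemma fuse_ones a : fuse (comp_ones (rows a)) (comp_ones (cols a)) = a.
Proof.
transitivity (mk_matcomp (entriesP a)); last first.
  by apply: val_inj; case: a => -[[]].
apply: mk_matcomp_eq; rewrite ?size_nseq // => r s r' s' er es.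
rewrite mxE (big_pred1 r') => [|u]; last by rewrite in_block_ones er.
by rewrite (big_pred1 s') // => v; rewrite in_block_ones es.
Qed.

End Fuse.

(** * Linear maps on a free module *)

Lemma malg_sum_basis (T : choiceType) (K : nzRingType) (x : {malg K[T]}) :
  x = \sum_(k <- msupp x) x@_k *: << k >>.
Proof.
rewrite [LHS]monalgE; apply: eq_bigr => k _; apply/malgP => l.
by rewrite mcoeffZ [in RHS]mcoeffU mcoeffU [RHS]mulr_natr.
Qed.

Lemma lin_ext_cancel (T : choiceType) (K : nzRingType)
    (f g : T -> {malg K[T]}) :
  (forall k, lin_ext g (f k) = << k >>) -> cancel (lin_ext f) (lin_ext g).
Proof.
move=> fgK x; rewrite [X in lin_ext _ X]/lin_ext linear_sum /=.
rewrite [RHS]malg_sum_basis.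
by apply: eq_bigr => k _; rewrite linearZ /= fgK.
Qed.

(** * The operators attached to a sequence of weights *)

Section FuseSum.
Variables (K : comNzRingType) (d : nat).
Implicit Types (f g : nat -> K) (a : matcomp d).

Definition fuse_sum f a : {malg K[matcomp d]} :=
  \sum_(I : composition (rows a)) \sum_(J : composition (cols a))
    (weight f I * weight f J) *: << fuse I J >>.

Lemma fuse_sum_empty f : fuse_sum f (empty_matcomp d) = << empty_matcomp d >>.
Proof.
have -> : fuse_sum f (empty_matcomp d) =
    (weight f (comp_ones 0) * weight f (comp_ones 0)) *:
      << @fuse d (empty_matcomp d) (comp_ones 0) (comp_ones 0) >>.
  by apply: etrans (sum_composition0 _) _; exact: sum_composition0.
by rewrite /weight big_nil mulr1 scale1r (fuse_ones (empty_matcomp d)).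
Qed.

(** After [fuse_fuse] the fourfold sum factors into a sum over the row data
    [(I, I')] and one over the column data [(J, J')]; each collapses by
    [sum_comp_merge_inv]. *)
Lemma lin_ext_fuse_sum f g a : (forall k, wconv f g k.+1 = (k == 0%N)%:R) ->
  lin_ext (fuse_sum g) (fuse_sum f a) = << a >>.
Proof.
move=> fg1; rewrite /fuse_sum linear_sum /=.
pose colsum (L : composition (rows a)) : {malg K[matcomp d]} :=
  \sum_(J : composition (cols a)) \sum_(J' : composition (size J))
    (weight f J * weight g J') *: << fuse L (comp_merge J') >>.
transitivity (\sum_(I : composition (rows a)) \sum_(I' : composition (size I))
  (weight f I * weight g I') *: colsum (comp_merge I')).
  apply: eq_bigr => I _; rewrite linear_sum /=.
  under [RHS]eq_bigr => I' _ do rewrite scaler_sumr.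
  rewrite [RHS]exchange_big; apply: eq_bigr => J _ /=.
  rewrite linearZ /= lin_extU scaler_sumr; apply: eq_bigr => I' _.
  rewrite !scaler_sumr; apply: eq_bigr => J' _.
  by rewrite !scalerA mulrACA fuse_fuse.
rewrite (sum_comp_merge_inv colsum fg1) /colsum.
rewrite (sum_comp_merge_inv
  (fun L => << fuse (comp_ones (rows a)) L >>) fg1).
by rewrite fuse_ones.
Qed.

Lemma lin_ext_fuse_sumK f g : (forall k, wconv f g k.+1 = (k == 0%N)%:R) ->
  cancel (lin_ext (fuse_sum f)) (lin_ext (fuse_sum g)).
Proof. by move=> fg1; apply: lin_ext_cancel => a; exact: lin_ext_fuse_sum. Qed.

End FuseSum.

(** The empty matrix composition falls under the general formula, [0] having the
    empty composition as its only one. *)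
Lemma hoffman_basisE (K : comAlgType rat) d (a : matcomp d) :
  hoffman_basis K a = fuse_sum (fun k => (exp_weight k)%:A) a.
Proof.
rewrite /hoffman_basis; case: eqP => [->|_]; first by rewrite fuse_sum_empty.
apply: eq_bigr => I _.
apply: eq_bigr => J _.
set w := weight _; have -> : w I * w J =
    (((composition_fact I * composition_fact J)%:R)^-1 : rat)%:A; last by [].
rewrite /w !(rmorph_weight (in_alg K)) !weight_expE.
by rewrite -rmorphM -invfM -natrM.
Qed.

Theorem lemma4p11 (K : comAlgType rat) (d : nat) (hd : (0 < d)%N) :
  exists Psi : {linear {malg K[matcomp d]} -> {malg K[matcomp d]}},
    [/\ cancel (hoffman K d) Psi,
        cancel Psi (hoffman K d) &
        forall a : matcomp d, a != empty_matcomp d ->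
          Psi << a >> =
            \sum_(I : composition (rows a)) \sum_(J : composition (cols a))
              (((-1) ^+ ((rows a - size I) + (cols a - size J))%N
                / (composition_prod I * composition_prod J)%:R) : rat)%:A
                *: << fuse I J >>].
Proof.
pose fK (f : nat -> rat) k := in_alg K (f k).
have hoffE : hoffman K d =1 lin_ext (fuse_sum (fK exp_weight)).
  by move=> x; apply: eq_bigr => a _; rewrite hoffman_basisE.
exists (lin_ext (fuse_sum (fK log_weight))); split.
- move=> x; rewrite hoffE; apply: lin_ext_fuse_sumK => k.
  by rewrite rmorph_wconv wconv_exp_log rmorph_nat.
- move=> x; rewrite hoffE; apply: lin_ext_fuse_sumK => k.
  by rewrite rmorph_wconv wconv_log_exp rmorph_nat.
move=> a _; apply: etrans (lin_extU _ _) _.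
apply: eq_bigr => I _; apply: eq_bigr => J _.
set w := weight _; have -> : w I * w J =
    (((-1) ^+ ((rows a - size I) + (cols a - size J))%N
      / (composition_prod I * composition_prod J)%:R) : rat)%:A; last by [].
rewrite /w !rmorph_weight !weight_logE -rmorphM.
by rewrite mulrACA -exprD -invfM natrM.
Qed.
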